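(* Let $S$ be a countable (infinite) set with rates $c_{x,y}\in[0,+\infty)$, $x\ne y$ in $S$ (not necessarily symmetric), satisfying Assumption SEP with $t_0>0$. For $x,y\in S$ let $p(x,y):=\mathbb P(x\longleftrightarrow y\text{ in }\mathcal G_{t_0})$. The condition $$\mathbb E\big[|\mathcal C_{t,x}|\big]<+\infty\qquad\forall x\in S,\ \forall t\in\mathbb R_+$$ is satisfied if for all $x\in S$ and $n\in\mathbb N_+$ $$\sum_{x_1,x_2,\dots,x_n\in S}p(x,x_1)p(x_1,x_2)\cdots p(x_{n-1},x_n)<+\infty;$$ equivalently, if for all $x\in S$ and $n\in\mathbb N$ $$\sum_{x_1,x_2,\dots,x_n\in S}p(x,x_1)p(x_1,x_2)\cdots p(x_{n-1},x_n)\,\mathbb E\big[|\mathcal C_{t_0,x_n}|\big]<+\infty.$$ The condition $$\mathbb E\Big[\sum_{z\in\mathcal C_{t,x}}c^s_z\Big]<+\infty\qquad\forall x\in S,\ \forall t\in\mathbb R_+$$ is satisfied if for all $x\in S$ and $n\in\mathbb N_+$ $$\sum_{x_1,x_2,\dots,x_n\in S}p(x,x_1)p(x_1,x_2)\cdots p(x_{n-1},x_n)\,c^s_{x_n}<+\infty;$$ equivalently, if for all $x\in S$ and $n\in\mathbb N$ $$\sum_{x_1,x_2,\dots,x_n\in S}p(x,x_1)p(x_1,x_2)\cdots p(x_{n-1},x_n)\,\mathbb E\Big[\sum_{w\in\mathcal C_{t_0,x_n}}c^s_w\Big]<+\infty.$$ For $n=0$ the second and fourth displayed sums are to be read as $\mathbb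 E[|\mathcal C_{t_0,x}|]<+\infty$ and $\mathbb E[\sum_{w\in\mathcal C_{t_0,x}}c^s_w]<+\infty$ respectively.
   Context: Setting. $S$ is a countable (infinite) set; $\mathcal E_S^o:=\{(x,y):x\ne y,\ x,y\in S\}$ (ordered pairs), $\mathcal E_S:=\{\{x,y\}:x\neq y,\ x,y\in S\}$ (unordered pairs). To each $(x,y)\in\mathcal E_S^o$ is associated $c_{x,y}\in[0,+\infty)$, not assumed symmetric; $c_{x,x}:=0$; $c^s_{x,y}:=c_{x,y}+c_{y,x}$; $c^s_x:=\sum_{y\in S}c^s_{x,y}$ (finite under Assumption SEP below). $\mathbb N=\{0,1,2,\dots\}$, $\mathbb N_+=\{1,2,\dots\}$. $D_{\mathbb N}$ is the space of càdlàg paths $\mathbb R_+=[0,+\infty)\to\mathbb N$ ($\mathbb N$ discrete) with the Skorohod topology; $D_{\mathbb N}^{\mathcal E_S^o}$ has the product topology, with generic element $\mathcal K=(\mathcal K_{x,y})_{(x,y)\in\mathcal E_S^o}$. $\mathbb P$ (with expectation $\mathbb E$) is the law on $D_{\mathbb N}^{\mathcal E_S^o}$ of a family $(N_{x,y}(\cdot))_{(x,y)\in\mathcal E_S^o}$ of independent Poisson processes, $N_{x,y}$ having intensity $c_{x,y}$ and $N_{x,y}(0)=0$. For $\{x,y\}\in\mathcal E_S$, $\mathcal K^s_{x,y}(t):=\mathcal K_{x,y}(t)+\mathcal K_{y,x}(t)$. Assumption SEP: there exists $t_0>0$ such that for $\mathbb P$-a.a. $\mathcal K$ the undirected graph $\mathcal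 G_{t_0}(\mathcal K)$ with vertex set $S$ and edge set $\{\{x,y\}\in\mathcal E_S:\mathcal K^s_{x,y}(t_0)>\mathcal K^s_{x,y}(0)\}$ has only connected components of finite cardinality. Such a $t_0$ is fixed. For $r\in\mathbb N$, $\mathcal G^r_{t_0}(\mathcal K)$ is the graph with vertex set $S$ and edge set $\{\{x,y\}\in\mathcal E_S:\mathcal K^s_{x,y}((r+1)t_0)>\mathcal K^s_{x,y}(rt_0)\}$ (so $\mathcal G^0_{t_0}=\mathcal G_{t_0}$); $\mathbb P$-a.s. all these graphs have only finite connected components. Given $x\in S$, $r\in\mathbb N$ and such $\mathcal K$: let $C_0$ be the connected component of $x$ in $\mathcal G^r_{t_0}(\mathcal K)$ and, for $j=1,\dots,r$, let $C_j$ be the union over $y\in C_{j-1}$ of the connected components of $y$ in $\mathcal G^{r-j}_{t_0}(\mathcal K)$. Set $B_{r,x}(\mathcal K):=C_r$, $\mathcal C_{t,x}(\mathcal K):=B_{r,x}(\mathcal K)$ for $rt_0<t\le(r+1)t_0$, and $\mathcal C_{0,x}:=\{x\}$. In particular $\mathcal C_{t_0,x}(\mathcal K)$ is the connected component of $x$ in $\mathcal G_{t_0}(\mathcal K)$. $x\longleftrightarrow y$ in $\mathcal G_{t_0}(\mathcal K)$ means that $x$ and $y$ belong to the same connected component of $\mathcal G_{t_0}(\mathcal K)$, i.e. $y\in\mathcal C_{t_0,x}(\mathcal K)$ (so $p(x,x)=1$). *)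

(* Defs.v *)
From HB Require Import structures.
From mathcomp Require Import all_boot all_order all_algebra.
From mathcomp Require Import finmap.
From mathcomp Require Import all_classical all_reals all_analysis.
Import Order.TTheory GRing.Theory Num.Theory.
Import numFieldNormedType.Exports.

Set Implicit Arguments.
Unset Strict Implicit.
Unset Printing Implicit Defensive.

Local Open Scope classical_set_scope.
Local Open Scope ring_scope.

(* Paths R_+ -> nat are functions R -> nat whose values at negative times are
   never used.  The topology of nat is discrete. *)
Definition cadlag (R : realType) (f : R -> nat) : Prop :=
  (forall t, 0 <= t -> f s @[s --> t^'+] --> f t) /\
  (forall t, 0 < t -> cvg (f s @[s --> t^'-])).

Section Probability.
Context (R : realType) (d : measure_display) (Omega : measurableType d).
Variable P : probability Omega R.

Definition mutually_independent (I : choiceType) (D : set I)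
    (F : I -> set_system Omega) : Prop :=
  forall (J : {fset I}) (E : I -> set Omega),
    [set` J] `<=` D -> (forall i, i \in J -> F i (E i)) ->
    P (\bigcap_(i in [set` J]) E i) = (\prod_(i <- J) P (E i))%E.

Implicit Types X : Omega -> R -> nat.

(* Integer-valued: truncated subtraction in nat would send the negative
   increments to 0. *)
Definition increment X (s t : R) (w : Omega) : int := (X w t)%:Z - (X w s)%:Z.

(* The second argument of [poisson_prob] is a dummy; for rate 0 this law is the
   Dirac mass at 0, so that lambda = 0 is covered. *)
Definition poisson_process (lambda : R) X : Prop :=
  [/\ forall t, 0 <= t -> measurable_fun [set: Omega] (fun w => X w t),
      forall w, cadlag (X w),
      {ae P, forall w, X w 0 = 0%N},
      forall (s t : R) (U : set nat), 0 <= s -> s <= t ->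
        P (increment X s t @^-1` (Posz @` U)) =
        poisson_prob (lambda * (t - s)) 0 U
    & forall u : nat -> R, 0 <= u 0%N -> nondecreasing_seq u ->
        mutually_independent [set: nat] (fun i =>
          preimage_set_system [set: Omega] (increment X (u i) (u i.+1))
            [set: set int])].

Definition process_sigma_algebra X : set_system Omega :=
  <<s \bigcup_(t in [set t | 0 <= t])
        preimage_set_system [set: Omega] (fun w => X w t) measurable >>.

End Probability.

Section Graphs.
Context (R : realType) (S : countType).

Definition ordered_pairs : set (S * S) := [set e | e.1 != e.2].

(* K x y is the path K_{x,y}; the diagonal entries K x x are never used. *)
Implicit Types K : S -> S -> R -> nat.

(* The underlying probability space is arbitrary: the law of K on the path space
   is then the one in question, and the path space itself, with K the identity,
   is the canonical example. *)
Definition poisson_family d (Omega : measurableType d) (P : probability Omega R)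
    (c : S -> S -> R) (K : Omega -> S -> S -> R -> nat) : Prop :=
  (forall x y, x != y -> poisson_process P (c x y) (fun w => K w x y)) /\
  mutually_independent P ordered_pairs
    (fun e => process_sigma_algebra (fun w => K w e.1 e.2)).

Definition sym_path K (x y : S) (t : R) : nat := (K x y t + K y x t)%N.

Definition jump_graph K (a b : R) : rel S :=
  fun x y => (x != y) && (sym_path K x y a < sym_path K x y b)%N.

Definition component (e : rel S) (x : S) : set S :=
  [set y | exists2 s : seq S, path e x s & last x s = y].

Definition graph0 (t0 : R) K : rel S := jump_graph K 0 t0.

Definition graph_at (t0 : R) K (r : nat) : rel S :=
  jump_graph K (r%:R * t0) (r.+1%:R * t0).

Fixpoint backward_set (t0 : R) K (r : nat) (x : S) (j : nat) : set S :=
  if j is j'.+1 then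
    \bigcup_(y in backward_set t0 K r x j') component (graph_at t0 K (r - j)) y
  else component (graph_at t0 K r) x.

Definition Bset (t0 : R) K (r : nat) (x : S) : set S := backward_set t0 K r x r.

(* For t > 0 the union is over the single r with r t0 < t <= (r + 1) t0. *)
Definition graph_cluster (t0 : R) K (t : R) (x : S) : set S :=
  if t == 0 then [set x]
  else \bigcup_(r in [set r | r%:R * t0 < t <= r.+1%:R * t0]) Bset t0 K r x.

Definition assumption_SEP d (Omega : measurableType d) (P : probability Omega R)
    (K : Omega -> S -> S -> R -> nat) (t0 : R) : Prop :=
  0 < t0 /\
  {ae P, forall w, forall x, finite_set (component (graph0 t0 (K w)) x)}.

Definition conn_prob d (Omega : measurableType d) (P : probability Omega R)
    (K : Omega -> S -> S -> R -> nat) (t0 : R) (x y : S) : \bar R :=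
  P [set w | component (graph0 t0 (K w)) x y].

Definition total_rate (c : S -> S -> R) (x : S) : \bar R :=
  (\esum_(y in [set: S]) (c x y + c y x)%:E)%E.

(* p(x, x_1) p(x_1, x_2) ... p(x_{n-1}, x_n) for s = [:: x_1; ...; x_n] *)
Definition chain_prod (p : S -> S -> \bar R) (x : S) (s : seq S) : \bar R :=
  (\prod_(0 <= i < size s) p (nth x (x :: s) i) (nth x s i))%E.

End Graphs.

(* Main.v *)
Require Import Defs.
From HB Require Import structures.
From mathcomp Require Import all_boot all_order all_algebra.
From mathcomp Require Import finmap.
From mathcomp Require Import all_classical all_reals all_analysis.
From mathcomp Require Import measurable_realfun zify.
Import Order.TTheory GRing.Theory Num.Theory.
Import numFieldNormedType.Exports.
Local Open Scope classical_set_scope.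
Local Open Scope ring_scope.
Local Open Scope ereal_scope.

Set Implicit Arguments.
Unset Strict Implicit.
Unset Printing Implicit Defensive.

(** Both conditions are instances of one statement about a weight f >= 0 on S:
with f = 1 the sum of f over the cluster is the number of its points, with
f = c^s it is the total rate of the cluster.

Let p be the connection probability of the graph at level 0.  The cluster at
time t, r t0 < t <= (r + 1) t0, is reached from x by a chain x_1, ..., x_(r+1)
in which x_(i+1) belongs to the component of x_i in the graph of level r - i.
Two facts give the probability of such a chain.  The graph of level r is
a function of the Poisson increments over the r-th time slice, and the families
of increments over distinct slices are independent; hence the events along the
chain are independent.  The increments over all slices have the same law; hence
each event has the probability it would have at level 0.  The chain therefore
has probability p(x, x_1) ... p(x_r, x_(r+1)) ([backward_chain_prob]), and the
union bound over chains gives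
  E[sum of f over the cluster]
    <= sum over (x_1, ..., x_(r+1)) of p(x, x_1) ... p(x_r, x_(r+1)) f(x_(r+1))
([cluster_mass_le]).  Time 0 is covered by p(x, x) = 1, which makes f(x) a term
of the chain sum of length 1.

For t = t0 the bound is an equality, because the cluster is then a component of
the graph of level 0: E[sum of f over the cluster of y] is the sum over z of
p(y, z) f(z) ([cluster_mass_t0]).  Inserting it for y = x_n in the chain sum of
length n produces the chain sum of length n + 1 ([chain_mass_cluster_mass]),
which is why the two families of summability conditions are equivalent.

Independence and equality in law are assumed for increments of finitely many
processes, whereas being connected in a graph depends on infinitely many.  Both
pass from cylinder events to all events by one pi-lambda argument
([pi_system_product]). *)

(** * Counting and sums over countable types *)

Lemma counting_esum (R : realType) (T : choiceType) (A : set T) :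
  counting A = \esum_(x in A) (1 : \bar R).
Proof.
rewrite /counting; case: asboolP => finA.
  rewrite esum_fset// fsbig_finite//= sumEFin big_const_seq count_predT.
  by rewrite iter_addr_0.
apply/esym/eq_infty => r.
have [n rn] : exists n : nat, (r <= n%:R)%R.
  by exists (Num.truncn r).+1; rewrite ltW// truncnS_gt.
have [B BA Bn] := infinite_set_fset n finA.
apply: esum_ge; exists [set` B]; first by split.
rewrite fsbig_finite//= set_fsetK sumEFin big_const_seq count_predT.
by rewrite iter_addr_0 lee_fin (le_trans rn)// ler_nat.
Qed.

Lemma le_esum_subset (R : realType) (T : choiceType) (A B : set T)
    (a : T -> \bar R) :
  A `<=` B -> (forall x, B x -> 0 <= a x) ->
  \esum_(x in A) a x <= \esum_(x in B) a x.
Proof.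
move=> AB a0; rewrite esum_mkcond [leRHS]esum_mkcond.
apply: le_esum => x _; case: ifPn => [/set_mem/AB xB|_]; first by rewrite mem_set.
by case: ifPn => // /set_mem/a0.
Qed.

Section CountableSums.
Context (R : realType) (T : countType).
Implicit Type a : T -> \bar R.

(** Writing the sum as a series gives access to the results on series: scaling,
measurability and the exchange with an integral. *)
Lemma esum_pickle a : (forall t, 0 <= a t) ->
  \esum_(t in [set: T]) a t = \sum_(n <oo) oapp a 0 (pickle_inv n).
Proof.
move=> a0; rewrite nneseries_esumT; last by move=> n; case: pickle_inv => /=.
transitivity (\esum_(n in range (@choice.pickle T)) oapp a 0 (pickle_inv n)).
  rewrite esum_image; first by apply: eq_esum => t _; rewrite pickleK_inv.
  by move=> t u _ _; exact: (pcan_inj choice.pickleK).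
rewrite esum_mkcond; apply: eq_esum => n _; case: ifPn => // nT.
have := @pickle_invK T n; case: pickle_inv => //= t tn.
by move: nT; rewrite notin_setE; case; exists t.
Qed.

Lemma esumZl a (k : \bar R) : k \is a fin_num -> (forall t, 0 <= a t) ->
  0 <= k -> \esum_(t in [set: T]) (k * a t) = k * \esum_(t in [set: T]) a t.
Proof.
move=> kfin a0 k0; rewrite !esum_pickle//; last by move=> t; rewrite mule_ge0.
rewrite -[in RHS](fineK kfin) -nneseriesZl; last first.
  by move=> n _; case: pickle_inv => /=.
apply: eq_eseriesr => n _; rewrite fineK//.
by case: pickle_inv => //=; rewrite mule0.
Qed.

Context d (Omega : measurableType d) (mu : {measure set Omega -> \bar R}).

Lemma measurable_esum (g : T -> Omega -> \bar R) :
  (forall t, measurable_fun setT (g t)) -> (forall t w, 0 <= g t w) ->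
  measurable_fun setT (fun w => \esum_(t in [set: T]) g t w).
Proof.
move=> mg g0; under eq_fun do rewrite esum_pickle//.
rewrite (_ : (fun w => _) = fun w => \sum_(0 <= n <oo | n \in setT)
    oapp (g ^~ w) 0 (pickle_inv n)).
  apply: ge0_emeasurable_sum => [n w _ _|n _]; first by case: pickle_inv => /=.
  by case: pickle_inv => [t|] /=.
by apply/funext => w; apply: eq_eseriesl => n; rewrite in_setT.
Qed.

Lemma integral_esum (g : T -> Omega -> \bar R) :
  (forall t, measurable_fun setT (g t)) -> (forall t w, 0 <= g t w) ->
  \int[mu]_w (\esum_(t in [set: T]) g t w) =
  \esum_(t in [set: T]) \int[mu]_w g t w.
Proof.
move=> mg g0; under eq_integral do rewrite esum_pickle//.
rewrite esum_pickle; last by move=> t; exact: integral_ge0.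
rewrite integral_nneseries//.
- apply: eq_eseriesr => n _; case: pickle_inv => //=.
  exact: integral0.
- by move=> n; case: pickle_inv => [t|] /=.
- by move=> n w _; case: pickle_inv => /=.
Qed.

Lemma measurable_if_cst (A : set Omega) (k : \bar R) :
  measurable A -> measurable_fun setT (fun w => if w \in A then k else 0).
Proof.
move=> mA; apply: measurable_fun_ifT => //; apply: (measurable_fun_bool true).
by rewrite setTI (_ : _ @^-1` _ = A)//; apply/seteqP; split => w => [/set_mem|/mem_set].
Qed.

Lemma integral_if_cst (A : set Omega) (k : \bar R) :
  measurable A -> \int[mu]_w (if w \in A then k else 0) = k * mu A.
Proof. by move=> mA; rewrite -integral_cst// [RHS]integral_mkcond. Qed.

End CountableSums.

Lemma esum_tuple_rcons (R : realType) (S : countType) (n : nat)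
    (a : seq S -> \bar R) : (forall s, 0 <= a s) ->
  \esum_(s in [set: n.+1.-tuple S]) a s =
  \esum_(s in [set: n.-tuple S]) \esum_(y in [set: S]) a (rcons s y).
Proof.
move=> a0; rewrite esum_esum//.
rewrite (reindex_esum ([set: n.-tuple S] `*`` fun=> [set: S]) setT
  (fun sy => [tuple of rcons sy.1 sy.2]))//.
split => //.
- move=> [s y] [s' y'] _ _ /(congr1 val) /= /rcons_inj[/val_inj -> ->] //.
- move=> [s sn] _; case/lastP: s sn => // s y sn.
  have sn' : size s == n by move: (sn); rewrite size_rcons eqSS.
  by exists (Tuple sn', y) => //; exact: val_inj.
Qed.
(** * From a pi-system to the generated sigma-algebra *)

Lemma measurable_preimage {d d'} {T : measurableType d} {U : measurableType d'}
    (f : T -> U) (B : set U) :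
  measurable_fun setT f -> measurable B -> measurable (f @^-1` B).
Proof. by move=> mf mB; rewrite -[X in measurable X]setTI; exact: mf. Qed.

(** The factors are moved from the pi-system to the sigma-algebra one at a time:
with all other factors fixed, the sets B that satisfy the formula in the k-th
place form a lambda-system.  Comparing every Z i with the single Z0, instead of
with itself, yields independence and equality in law at once. *)
Lemma pi_system_product (R : realType) d (Omega : measurableType d)
    (P : probability Omega R) d' (U : measurableType d') (G : set_system U)
    (Z : nat -> Omega -> U) (Z0 : Omega -> U) (m : nat) :
  @measurable _ U = <<s G >> -> setI_closed G -> G setT ->
  (forall i, measurable_fun setT (Z i)) -> measurable_fun setT Z0 ->
  (forall A : nat -> set U, (forall i, G (A i)) ->
    P (\bigcap_(i in `I_m) (Z i @^-1` A i)) =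
    \prod_(i < m) P (Z0 @^-1` A i)) ->
  forall A : nat -> set U, (forall i, measurable (A i)) ->
    P (\bigcap_(i in `I_m) (Z i @^-1` A i)) = \prod_(i < m) P (Z0 @^-1` A i).
Proof.
move=> GE GI GT mZ mZ0 base A mA.
have GM : G `<=` measurable by rewrite GE; exact: sub_gen_smallest.
have mcap (B : nat -> set U) : (forall i, measurable (B i)) ->
    measurable (\bigcap_(i in `I_m) (Z i @^-1` B i)).
  move=> mB; apply: bigcap_measurableType => // i _.
  exact: measurable_preimage.
have claim k : forall B : nat -> set U, (forall i, measurable (B i)) ->
    (forall i, (k <= i)%N -> G (B i)) ->
    P (\bigcap_(i in `I_m) (Z i @^-1` B i)) = \prod_(i < m) P (Z0 @^-1` B i).
  elim: k => [|k IH] B mB GB; first by apply: base => i; exact: GB.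
  pose upd (D : set U) i := if i == k then D else B i.
  have updB : upd (B k) = B.
    by apply/funext => i; rewrite /upd; case: eqP => [->|].
  have mupd (D : set U) i : measurable D -> measurable (upd D i).
    by move=> mD; rewrite /upd; case: ifP.
  have Gupd (D : set U) : G D ->
      P (\bigcap_(i in `I_m) (Z i @^-1` upd D i)) =
      \prod_(i < m) P (Z0 @^-1` upd D i).
    move=> GD; apply: IH => i; first exact/mupd/GM.
    rewrite /upd; case: eqP => // /eqP ik ki.
    by apply: GB; rewrite ltn_neqAle eq_sym ik.
  have [mk|km] := leqP m k.
    rewrite (_ : \bigcap_(i in _) _ =
        \bigcap_(i in `I_m) (Z i @^-1` upd setT i)).
      rewrite Gupd//; apply: eq_bigr => i _; rewrite /upd.
      by rewrite ltn_eqF// (leq_trans (ltn_ord i)).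
    apply: eq_bigcapr => i /= im; rewrite /upd.
    by rewrite ltn_eqF// (leq_trans im).
  (* C and q collect the factors other than the k-th. *)
  pose C := \bigcap_(i in `I_m) (Z i @^-1` upd setT i).
  pose q := \prod_(i < m | i != Ordinal km) P (Z0 @^-1` B i).
  have mC : measurable C by apply: mcap => i; exact: mupd.
  have capE D : \bigcap_(i in `I_m) (Z i @^-1` upd D i) = C `&` Z k @^-1` D.
    apply/seteqP; split => w /= h.
      split => [i /= im|]; last by have := h _ km; rewrite /upd eqxx.
      by have := h _ im; rewrite /upd; case: ifP.
    move=> i /= im; have := h.1 _ im; rewrite /upd; case: eqP => // -> _.
    exact: h.2.
  have prodE D : \prod_(i < m) P (Z0 @^-1` upd D i) = q * P (Z0 @^-1` D).
    rewrite (bigD1 (Ordinal km))//= muleC /upd eqxx; congr (_ * _).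
    apply: eq_bigr => i; rewrite -(inj_eq val_inj)/= => /negbTE ik.
    by rewrite /upd ik.
  have qfin : q \is a fin_num.
    by apply: prode_fin_num => i _; rewrite fin_num_measure//;
      exact: measurable_preimage.
  have key D : <<s G >> D -> P (C `&` Z k @^-1` D) = q * P (Z0 @^-1` D).
    have mpre D' : measurable D' -> measurable (Z k @^-1` D').
      by move=> mD'; exact: measurable_preimage.
    have mpre0 D' : measurable D' -> measurable (Z0 @^-1` D').
      by move=> mD'; exact: measurable_preimage.
    have onG D' : G D' -> P (C `&` Z k @^-1` D') = q * P (Z0 @^-1` D').
      by move=> GD; rewrite -capE -prodE Gupd.
    move: D; apply: (@dynkin_induction _ _ G) => //=.
    - exact: onG.
    - move=> D mD IHD; rewrite -preimage_setC -setDE measureD//; last 2 first.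
      + exact: mpre.
      + by rewrite (le_lt_trans (probability_le1 P mC))// ltry.
      have PC : P C = q.
        by have := onG _ GT; rewrite !preimage_setT setIT probability_setT mule1.
      rewrite preimage_setC probability_setC; last exact: mpre0.
      rewrite muleBr ?fin_num_adde_defr// mule1.
      by congr (_ - _); [exact: PC|exact: IHD].
    - move=> F mF tF IHF; rewrite !preimage_bigcup setI_bigcupr.
      rewrite !measure_bigcup//.
      + rewrite -(fineK qfin) -nneseriesZl// fineK//.
        by apply: eq_eseriesr => i _; exact: IHF.
      + by move=> i _; exact: mpre0.
      + by move=> i j _ _ [w [Fi Fj]]; apply: tF => //; exists (Z0 w).
      + by move=> i _; apply: measurableI => //; exact: mpre.
      + by move=> i j _ _ [w [[_ Fi] [_ Fj]]]; apply: tF => //; exists (Z k w).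
  by rewrite -updB capE prodE key// -GE.
(* After m steps only the sets of index below m have been moved; the others are
   not seen by the formula and are replaced by setT, which is in G. *)
pose A' i := if (i < m)%N then A i else setT.
have -> : \bigcap_(i in `I_m) (Z i @^-1` A i) =
    \bigcap_(i in `I_m) (Z i @^-1` A' i).
  by apply: eq_bigcapr => i /= im; rewrite /A' im.
rewrite (claim m) => [|i|i mi]; last 2 first.
- by rewrite /A'; case: ifP.
- by rewrite /A' ltnNge mi.
by apply: eq_bigr => i _; rewrite /A' ltn_ord.
Qed.
(** * Increments of a Poisson process *)

Lemma measurable_int_increment d (T : measurableType d) (f g : T -> nat)
    (V : set int) :
  measurable_fun setT f -> measurable_fun setT g ->
  measurable [set w | V ((g w)%:Z - (f w)%:Z)%R].
Proof.
move=> mf mg.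
pose B (ab : nat * nat) : set T :=
  [set w | V (ab.2%:Z - ab.1%:Z)%R] `&` (f @^-1` [set ab.1] `&` g @^-1` [set ab.2]).
rewrite (_ : [set w | _] = \bigcup_ab B ab); last first.
  apply/seteqP; split => w /=; first by move=> Vw; exists (f w, g w).
  by move=> [[a b] _ /= [Vab [-> ->]]].
apply: countable_bigcupT_measurable => // -[a b]; apply: measurableI.
  have [Vab|nV] := pselect (V (b%:Z - a%:Z)%R).
    by rewrite (_ : [set _ | _] = setT)//; apply/seteqP; split.
  by rewrite (_ : [set _ | _] = set0)//; apply/seteqP; split.
by apply: measurableI; exact: measurable_preimage.
Qed.

(** The measurability of increments is applied to the space equipped with the
sigma-algebra generated by the process itself; this is what independence of
distinct processes refers to. *)
Lemma increment_in_process_sigma_algebra (R : realType) d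
    (Omega : measurableType d) (X : Omega -> R -> nat) (s t : R) (V : set int) :
  (0 <= s)%R -> (0 <= t)%R ->
  process_sigma_algebra X (increment X s t @^-1` V).
Proof.
move=> s0 t0.
pose G : set_system Omega := \bigcup_(t in [set t : R | (0 <= t)%R])
  preimage_set_system [set: Omega] (fun w => X w t) measurable.
have mX u : (0 <= u)%R ->
    measurable_fun setT ((fun w => X w u) : g_sigma_algebraType G -> nat).
  move=> u0 _ B mB; apply: sub_sigma_algebra.
  by exists u => //; exists B.
exact: (@measurable_int_increment _ (g_sigma_algebraType G) _ _ V
  (mX _ s0) (mX _ t0)).
Qed.

(** The definition of a Poisson process gives the law of an increment on sets of
nonnegative integers; it has total mass 1 there, so that the negative integers
of V have probability 0. *)
Lemma poisson_increment_law (R : realType) d (Omega : measurableType d)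
    (P : probability Omega R) (lambda : R) (X : Omega -> R -> nat) (s t : R)
    (V : set int) :
  poisson_process P lambda X -> (0 <= s)%R -> (s <= t)%R ->
  P (increment X s t @^-1` V) =
  poisson_prob (lambda * (t - s)) 0 (Posz @^-1` V).
Proof.
move=> [mX _ _ law _] s0 st; have t0 := le_trans s0 st.
have mI (W : set int) : measurable (increment X s t @^-1` W).
  by apply: measurable_int_increment; exact: mX.
have PT : P (increment X s t @^-1` (Posz @` setT)) = 1.
  by rewrite law// probability_setT.
have P0 : P (increment X s t @^-1` (V `\` Posz @` setT)) = 0.
  apply/eqP; rewrite eq_le measure_ge0 andbT.
  apply: (@le_trans _ _ (P (~` (increment X s t @^-1` (Posz @` setT))))).
    apply: le_measure; rewrite ?inE//.
    - exact: measurableC.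
    - by move=> w /= [].
  by rewrite probability_setC// PT subee.
rewrite (measureDI _ (mI V) (mI (Posz @` setT))).
rewrite -[X in P X + _]/(increment X s t @^-1` (V `\` Posz @` setT)) P0 add0e.
rewrite -law//; congr (P _); apply/seteqP; split => w /=.
  by move=> [Vw [n _ nw]]; exists n => //=; rewrite nw.
by move=> [n Vn nw]; rewrite -nw; split => //; exists n.
Qed.
(** * Configurations of increments over one time slice *)

(* A measurable type has a distinguished element. *)
HB.instance Definition _ := isPointed.Build int 0%R.

(** Finitely many coordinates are constrained, those in J.  They lie off the
diagonal, because the diagonal paths of a Poisson family are arbitrary functions
and may fail to be measurable. *)
Definition cylinders (S : countType) : set_system (S * S -> int) :=
  [set A | exists (J : {fset S * S}) (V : S * S -> set int),
    [/\ [set` J] `<=` @ordered_pairs S, forall e, e \notin J -> V e = setT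
      & A = [set u | forall e, V e (u e)]]].

Definition config (S : countType) := g_sigma_algebraType (@cylinders S).

Lemma setI_closed_cylinders (S : countType) : setI_closed (@cylinders S).
Proof.
move=> _ _ [J [V [JS VT ->]]] [J' [V' [JS' VT' ->]]].
exists (J `|` J')%fset, (fun e => V e `&` V' e); split.
- by move=> e; rewrite /= inE => /orP[/JS|/JS'].
- by move=> e; rewrite inE negb_or => /andP[/VT -> /VT' ->]; rewrite setIT.
- apply/seteqP; split => u /=; first by move=> [Vu Vu'] e; split.
  by move=> h; split => e; have [] := h e.
Qed.

Lemma cylindersT (S : countType) : @cylinders S setT.
Proof.
exists fset0, (fun=> setT); split => //.
by apply/seteqP; split.
Qed.

Section Jumps.
Context (R : realType) (S : countType) (c : S -> S -> R).
Context d (Omega : measurableType d) (P : probability Omega R).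
Context (K : Omega -> S -> S -> R -> nat) (t0 : R).
Hypothesis K_poisson : poisson_family P c K.
Hypothesis t0_gt0 : (0 < t0)%R.

Definition jumps (r : nat) (w : Omega) : config S := fun e =>
  increment (fun w => K w e.1 e.2) (r%:R * t0) (r.+1%:R * t0) w.

Let time_ge0 (r : nat) : (0 <= r%:R * t0)%R.
Proof. by rewrite mulr_ge0// ltW. Qed.

Let timeS (r : nat) : (r%:R * t0 <= r.+1%:R * t0)%R.
Proof. by rewrite ler_pM2r// ler_nat. Qed.

Let poissonK e : ordered_pairs e ->
  poisson_process P (c e.1 e.2) (fun w => K w e.1 e.2).
Proof. by move: e => [x y] xy; exact: K_poisson.1. Qed.

Lemma measurable_jumps_coord (r : nat) (e : S * S) (V : set int) :
  ordered_pairs e -> measurable [set w | V (jumps r w e)].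
Proof.
move=> /poissonK[mX _ _ _ _].
by apply: measurable_int_increment; exact: mX.
Qed.

Lemma measurable_jumps (r : nat) : measurable_fun setT (jumps r).
Proof.
apply: (@measurability _ _ Omega (config S) _ _ (@cylinders S)) => // _ [_ [J [V [JS VT ->]] <-]].
rewrite setTI (_ : _ @^-1` _ =
    \bigcap_(e in [set` J]) [set w | V e (jumps r w e)]).
  apply: fin_bigcap_measurable => // e eJ.
  exact/measurable_jumps_coord/JS.
apply/seteqP; split => w /= h e; first by move=> _; exact: h.
by have [eJ|eJ] := boolP (e \in J); [exact: h|rewrite VT].
Qed.

(** Independence of the processes splits the event over the edges, independence of
the increments of each process splits it over the time slices.  No factor depends
on its slice except through the set V i e: this is stationarity. *)
Lemma cylinder_jumps_law (m : nat) (J : {fset S * S})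
    (V : nat -> S * S -> set int) :
  [set` J] `<=` @ordered_pairs S ->
  (forall i e, (i < m)%N -> e \notin J -> V i e = setT) ->
  P (\bigcap_(i in `I_m) (jumps i @^-1` [set u | forall e, V i e (u e)])) =
  \prod_(e <- J) \prod_(i < m)
     poisson_prob (c e.1 e.2 * t0) 0 (Posz @^-1` V i e).
Proof.
move=> JS VT.
pose I := [fset i in iota 0 m]%fset.
have inI i : (i \in I) = (i < m)%N by rewrite !inE/= mem_iota.
pose E e := \bigcap_(i in [set` I]) [set w | V i e (jumps i w e)].
rewrite (_ : \bigcap_(i in _) _ = \bigcap_(e in [set` J]) E e); last first.
  apply/seteqP; split => w /= h.
    by move=> e eJ i /=; rewrite inI => im; exact: h.
  move=> i /= im e; have [eJ|eJ] := boolP (e \in J); last by rewrite VT.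
  by apply: (h e eJ i); rewrite /= inI.
rewrite K_poisson.2//; last first.
  move=> e eJ; apply: (@bigcap_measurableType _ (g_sigma_algebraType _)) => i _.
  exact: increment_in_process_sigma_algebra.
rewrite big_seq [RHS]big_seq; apply: eq_bigr => e /JS eJ.
have [_ _ _ _ indep] := poissonK eJ.
have Ef : forall i, i \in I ->
    preimage_set_system [set: Omega] (increment (fun w => K w e.1 e.2)
      (i%:R * t0) (i.+1%:R * t0)) [set: set int] [set w | V i e (jumps i w e)].
  by move=> i _; exists (V i e) => //; rewrite setTI.
rewrite (indep (fun i => i%:R * t0)%R _ _ I)//.
- transitivity (\prod_(i <- iota 0 m) P [set w | V i e (jumps i w e)]).
    apply/perm_big/uniq_perm; rewrite ?fset_uniq ?iota_uniq// => i.
    by rewrite inI mem_iota.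
  rewrite -{1}[m]subn0 big_mkord; apply: eq_bigr => i _.
  rewrite (poisson_increment_law _ (poissonK eJ))//.
  by congr (poisson_prob (_ * _)%R _ _); rewrite -mulrBl -natrB// subSnn mul1r.
- by move=> i j; rewrite ler_pM2r// ler_nat.
Qed.

(** The increments over distinct slices are independent and distributed as those
over the slice of level 0. *)
Lemma jumps_product (m : nat) (A : nat -> set (config S)) :
  (forall i, measurable (A i)) ->
  P (\bigcap_(i in `I_m) (jumps i @^-1` A i)) =
  \prod_(i < m) P (jumps 0 @^-1` A i).
Proof.
apply: (@pi_system_product _ _ _ _ _ (config S) (@cylinders S) jumps (jumps 0)) => //.
- exact: setI_closed_cylinders.
- exact: cylindersT.
- exact: measurable_jumps.
- exact: measurable_jumps.
move=> {}A /choice[J /choice[V JV]].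
(* The law of cylinders is stated for one set of edges shared by all levels. *)
pose JU := (\bigcup_(i <- iota 0 m) J i)%fset.
have JUS : [set` JU] `<=` @ordered_pairs S.
  by move=> e /= /bigfcupP[i _]; have [+ _ _] := JV i; apply.
have VT i e : (i < m)%N -> e \notin JU -> V i e = setT.
  move=> im eJ; have [_ + _] := JV i; apply; apply: contra eJ => eJ.
  by apply/bigfcupP; exists i; rewrite ?mem_iota ?im.
have AE i : A i = [set u | forall e, V i e (u e)] by have [] := JV i.
under eq_bigcapr do rewrite AE.
rewrite (cylinder_jumps_law JUS VT) exchange_big/=; apply: eq_bigr => i _.
transitivity (P (\bigcap_(k in `I_1)
    (jumps k @^-1` [set u | forall e, V i e (u e)]))).
  rewrite (cylinder_jumps_law (V := fun=> V i) JUS); last first.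
    by move=> _ e _; exact: VT.
  by apply: eq_bigr => e _; rewrite big_ord1.
rewrite AE; congr (P _); apply/seteqP; split => w /=; last by move=> h [].
by move=> /(_ 0%N erefl).
Qed.


(** * Chains of components *)

Definition config_graph (u : config S) : rel S :=
  fun x y => (x != y) && (0 < u (x, y) + u (y, x))%R.

Definition connected_configs (x y : S) : set (config S) :=
  [set u | component (config_graph u) x y].

(** The difference of the values of the symmetrized path at the ends of a slice is
the sum of the two increments, whatever their signs. *)
Lemma graph_atE (r : nat) (w : Omega) :
  graph_at t0 (K w) r = config_graph (jumps r w).
Proof.
apply/funext => x; apply/funext => y.
rewrite /graph_at /jump_graph /config_graph /sym_path /jumps /increment /=.
congr (_ && _); lia.
Qed.

Lemma conn_probE (x y : S) :
  conn_prob P K t0 x y = P (jumps 0 @^-1` connected_configs x y).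
Proof.
congr (P _); apply/seteqP; split => w;
  by rewrite /= /connected_configs /= -graph_atE /graph_at mul0r mul1r.
Qed.

Lemma measurable_config_coord (e : S * S) (V : set int) :
  ordered_pairs e -> measurable [set u : config S | V (u e)].
Proof.
move=> eS; apply: sub_sigma_algebra.
exists [fset e]%fset, (fun e' => if e' == e then V else setT); split.
- by move=> e' /=; rewrite inE => /eqP ->.
- by move=> e'; rewrite inE => /negbTE ->.
- apply/seteqP; split => u /= h; last by have := h e; rewrite eqxx.
  by move=> e'; case: eqP => [->|].
Qed.

Lemma measurable_config_edge (x y : S) :
  measurable [set u : config S | config_graph u x y].
Proof.
have [xy|xy] := eqVneq x y.
  rewrite (_ : [set _ | _] = set0)//; apply/seteqP; split => // u /=.
  by rewrite /config_graph xy eqxx.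
rewrite (_ : [set _ | _] = \bigcup_(v : int)
    ([set u : config S | (u (x, y) = v)] `&`
     [set u : config S | (0 < v + u (y, x))%R])); last first.
  apply/seteqP; split => u /=; rewrite /config_graph xy /=.
    by move=> h; exists (u (x, y)).
  by move=> [v _ [/= -> ]].
apply: countable_bigcupT_measurable => // v; apply: measurableI.
  exact: (@measurable_config_coord (x, y) [set v]).
apply: (@measurable_config_coord (y, x) [set k | (0 < v + k)%R]).
by rewrite /ordered_pairs /= eq_sym.
Qed.

(** Connection is a countable union, over the finite paths from x to y, of finite
intersections of edge events. *)
Lemma measurable_connected_configs (x y : S) :
  measurable (connected_configs x y).
Proof.
have mpath (s : seq S) : forall a : S,
    measurable [set u : config S | path (config_graph u) a s].
  elim: s => [|b s IH] a /=.
    by rewrite (_ : [set _ | _] = setT)//; apply/seteqP; split.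
  rewrite (_ : [set _ | _] = [set u : config S | config_graph u a b] `&`
      [set u : config S | path (config_graph u) b s]).
    exact: measurableI (measurable_config_edge _ _) (IH b).
  by apply/seteqP; split => u /= => [/andP|/andP].
rewrite (_ : connected_configs x y = \bigcup_(s : seq S)
    if last x s == y then [set u : config S | path (config_graph u) x s]
    else set0).
  by apply: countable_bigcupT_measurable => // s; case: ifP.
apply/seteqP; split => u /=.
  by move=> [s us xsy]; exists s => //; rewrite xsy eqxx.
by move=> [s _]; case: eqP => // xsy us; exists s.
Qed.

(** The component that contains the entry of index i is taken at level r - i: time
is explored backwards, from slice r down to slice 0. *)
Definition backward_chain (r : nat) (x : S) (s : seq S) : set Omega :=
  [set w | forall i, (i < size s)%N ->
    component (graph_at t0 (K w) (r - i)) (nth x (x :: s) i) (nth x s i)].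

Lemma backward_setP (r j : nat) (x z : S) (w : Omega) :
  backward_set t0 (K w) r x j z <->
  exists s : j.+1.-tuple S, last x s = z /\ backward_chain r x s w.
Proof.
elim: j z => [|j IH] z.
  split => [xz|[s [<- sw]]] /=.
    by exists [tuple z]; split => // -[|i]//= _; rewrite subn0.
  case/tupleP: s sw => y s; rewrite tuple0 /= => /(_ 0%N erefl) /=.
  by rewrite subn0.
split => [[y /IH[s [sy sw]] yz]|[s [sz sw]]].
  exists [tuple of rcons s z]; rewrite /= last_rcons; split => // i /=.
  rewrite size_rcons size_tuple ltnS leq_eqVlt => /orP[/eqP ->|ij].
    rewrite -rcons_cons !nth_rcons /= size_tuple ltnn eqxx ltnSn.
    by have := last_nth x x s; rewrite sy size_tuple => /= <-.
  rewrite -rcons_cons !nth_rcons /= size_tuple ij ltnS (ltnW ij).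
  by apply: sw; rewrite size_tuple.
move: s sz sw => [s sj] /=; case/lastP: s sj => // s y.
rewrite size_rcons eqSS last_rcons => sj <-{z} sw.
exists (last x s).
  apply/IH; exists (Tuple sj); split => // i /= ij.
  have := sw i; rewrite size_rcons ltnS (ltnW ij) => /(_ erefl).
  by rewrite -rcons_cons !nth_rcons /= ij ltnS (ltnW ij).
have := sw (size s); rewrite size_rcons ltnSn => /(_ erefl).
rewrite -rcons_cons !nth_rcons /= ltnn eqxx ltnSn (eqP sj).
by rewrite (last_nth x) (eqP sj).
Qed.

Lemma backward_chainE (r : nat) (x : S) (s : r.+1.-tuple S) :
  backward_chain r x s = \bigcap_(k in `I_r.+1)
    (jumps k @^-1` connected_configs (nth x (x :: s) (r - k)) (nth x s (r - k))).
Proof.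
apply/seteqP; split => w /= sw.
  move=> k /= kr; rewrite /connected_configs /= -graph_atE.
  have := sw (r - k)%N; rewrite size_tuple ltnS leq_subr => /(_ erefl).
  by rewrite subKn.
move=> i; rewrite size_tuple => ir; rewrite graph_atE.
have := sw (r - i)%N; rewrite /= ltnS leq_subr => /(_ erefl).
by rewrite /connected_configs /= subKn.
Qed.

Lemma measurable_backward_chain (r : nat) (x : S) (s : r.+1.-tuple S) :
  measurable (backward_chain r x s).
Proof.
rewrite backward_chainE; apply: bigcap_measurableType => k _.
by apply: measurable_preimage;
  [exact: measurable_jumps|exact: measurable_connected_configs].
Qed.

(** The product formula lists the levels upwards and the chain visits them
downwards, hence the reversal of the index. *)
Lemma backward_chain_prob (r : nat) (x : S) (s : r.+1.-tuple S) :
  P (backward_chain r x s) = chain_prod (conn_prob P K t0) x s.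
Proof.
rewrite backward_chainE jumps_product; last first.
  by move=> k; exact: measurable_connected_configs.
rewrite /chain_prod big_mkord size_tuple [RHS](reindex_inj rev_ord_inj)/=.
by apply: eq_bigr => k _; rewrite subSS conn_probE.
Qed.

(** * Weighted cluster sums and chain sums *)

Lemma conn_prob_ge0 (x y : S) : 0 <= conn_prob P K t0 x y.
Proof. exact: measure_ge0. Qed.

Lemma conn_prob_fin_num (x y : S) : conn_prob P K t0 x y \is a fin_num.
Proof.
rewrite conn_probE fin_num_measure//; apply: measurable_preimage.
  exact: measurable_jumps.
exact: measurable_connected_configs.
Qed.

Lemma conn_prob_refl (x : S) : conn_prob P K t0 x x = 1.
Proof.
rewrite -(probability_setT P); congr (P _).
by apply/seteqP; split => // w _; exists [::].
Qed.

Lemma chain_prod_ge0 (x : S) (s : seq S) :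
  0 <= chain_prod (conn_prob P K t0) x s.
Proof. by apply: prode_ge0 => i _; exact: conn_prob_ge0. Qed.

Lemma chain_prod_fin_num (x : S) (s : seq S) :
  chain_prod (conn_prob P K t0) x s \is a fin_num.
Proof. by apply: prode_fin_num => i _; exact: conn_prob_fin_num. Qed.

(** The intervals ]r t0, (r + 1) t0] are disjoint, so that the union defining the
cluster has one term. *)
Lemma graph_clusterE (k : S -> S -> R -> nat) (r : nat) (t : R) (x : S) :
  (r%:R * t0 < t)%R -> (t <= r.+1%:R * t0)%R ->
  graph_cluster t0 k t x = Bset t0 k r x.
Proof.
move=> rt tr; rewrite /graph_cluster gt_eqF ?(le_lt_trans _ rt)//.
rewrite (_ : [set r | _] = [set r]) ?bigcup_set1//.
apply/seteqP; split => n /=; last by move=> ->; rewrite rt tr.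
move=> /andP[nt tn]; apply/eqP; rewrite eqn_leq.
by apply/andP; split; rewrite -ltnS -(ltr_nat R) -(ltr_pM2r t0_gt0);
  [exact: lt_le_trans nt tr|exact: lt_le_trans rt tn].
Qed.

Context (f : S -> \bar R).
Hypothesis f_ge0 : forall x, 0 <= f x.

Definition cluster_mass (t : R) (x : S) : \bar R :=
  \int[P]_w \esum_(z in graph_cluster t0 (K w) t x) f z.

Definition chain_mass (n : nat) (x : S) : \bar R :=
  \esum_(s in [set: n.-tuple S])
    (chain_prod (conn_prob P K t0) x s * f (last x s)).

Lemma cluster_mass0 (x : S) : cluster_mass 0 x = f x.
Proof.
rewrite /cluster_mass /graph_cluster eqxx.
under eq_integral do rewrite esum_set1//.
by rewrite (integral_cst P measurableT) [X in _ * X]probability_setT mule1.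
Qed.

(** The trivial chain from x to x has probability 1. *)
Lemma le_chain_mass1 (x : S) : f x <= chain_mass 1 x.
Proof.
apply: (@le_trans _ _ (\esum_(s in [set [tuple x]])
    (chain_prod (conn_prob P K t0) x s * f (last x s)))).
  rewrite esum_set1/=; first by rewrite /chain_prod big_nat1 conn_prob_refl mul1e.
  by rewrite mule_ge0// chain_prod_ge0.
by apply: le_esum_subset => // s _; rewrite mule_ge0// chain_prod_ge0.
Qed.

(** Exchange of sum and expectation (Tonelli). *)
Lemma cluster_mass_t0 (x : S) :
  cluster_mass t0 x = \esum_(y in [set: S]) (conn_prob P K t0 x y * f y).
Proof.
pose E y := jumps 0 @^-1` connected_configs x y.
have mE y : measurable (E y).
  by apply: measurable_preimage;
    [exact: measurable_jumps|exact: measurable_connected_configs].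
transitivity (\int[P]_w \esum_(y in [set: S]) if w \in E y then f y else 0).
  apply: eq_integral => w _.
  rewrite (@graph_clusterE _ 0) ?mul0r ?mul1r// esum_mkcond.
  apply: eq_esum => y _.
  by rewrite /Bset /= graph_atE; congr (if _ then _ else _); apply: asbool_equiv_eq.
rewrite integral_esum.
- by apply: eq_esum => y _; rewrite integral_if_cst// muleC conn_probE.
- by move=> y; exact: measurable_if_cst.
- by move=> y w; case: ifP.
Qed.

Lemma measurable_Bset (r : nat) (x z : S) :
  measurable [set w | Bset t0 (K w) r x z].
Proof.
rewrite (_ : [set _ | _] = \bigcup_(s : r.+1.-tuple S)
    if last x s == z then backward_chain r x s else set0).
  apply: countable_bigcupT_measurable => // s; case: ifP => // _.
  exact: measurable_backward_chain.
apply/seteqP; split => w /=.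
  by move=> /backward_setP[s [sz sw]]; exists s => //; rewrite sz eqxx.
by move=> [s _]; case: eqP => // sz sw; apply/backward_setP; exists s.
Qed.

(** Each point of the cluster is the endpoint of a chain; choosing one such chain
for every point is injective, since the point is read off the chain. *)
Lemma esum_Bset_le (r : nat) (x : S) (w : Omega) :
  \esum_(z in Bset t0 (K w) r x) f z <=
  \esum_(s in [set: r.+1.-tuple S])
    if w \in backward_chain r x s then f (last x s) else 0.
Proof.
have /choice[sigma sigmaP] : forall z, exists s : r.+1.-tuple S,
    Bset t0 (K w) r x z -> last x s = z /\ backward_chain r x s w.
  move=> z; have [/backward_setP[s sP]|nB] := pselect (Bset t0 (K w) r x z).
    by exists s.
  by exists [tuple of nseq r.+1 x].
pose g (s : r.+1.-tuple S) :=
  if w \in backward_chain r x s then f (last x s) else 0.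
rewrite (_ : esum _ f = \esum_(z in Bset t0 (K w) r x) g (sigma z)); last first.
  by apply: eq_esum => z /sigmaP[zs sw]; rewrite /g mem_set// zs.
rewrite -(esum_image _ _ g).
  by apply: le_esum_subset => // s _; rewrite /g; case: ifP.
move=> y z /set_mem/sigmaP[yE _] /set_mem/sigmaP[zE _] yz.
by rewrite -yE -zE yz.
Qed.

(** Union bound over the chains. *)
Lemma cluster_mass_le (r : nat) (t : R) (x : S) :
  (r%:R * t0 < t)%R -> (t <= r.+1%:R * t0)%R ->
  cluster_mass t x <= chain_mass r.+1 x.
Proof.
move=> rt tr; rewrite /cluster_mass.
under eq_integral do rewrite (graph_clusterE _ _ rt tr).
apply: (@le_trans _ _ (\int[P]_w \esum_(s in [set: r.+1.-tuple S])
    if w \in backward_chain r x s then f (last x s) else 0)).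
  apply: ge0_le_integral => //.
  - by move=> w _; exact: esum_ge0.
  - under eq_fun do rewrite esum_mkcond.
    apply: measurable_esum => [z|z w]; last by case: ifP.
    rewrite (_ : (fun w => _) =
        fun w => if w \in [set w | Bset t0 (K w) r x z] then f z else 0).
      by apply: measurable_if_cst; exact: measurable_Bset.
    by apply/funext => w; congr (if _ then _ else _); apply: asbool_equiv_eq.
  - apply: measurable_esum => [s|s w]; last by case: ifP.
    by apply: measurable_if_cst; exact: measurable_backward_chain.
  - by move=> w _; exact: esum_Bset_le.
rewrite integral_esum; last 2 first.
- by move=> s; apply: measurable_if_cst; exact: measurable_backward_chain.
- by move=> s w; case: ifP.
apply: le_esum => s _; rewrite integral_if_cst; last first.
  exact: measurable_backward_chain.
by rewrite muleC -backward_chain_prob.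
Qed.

(** The cluster sum at time t0 adds one last step to the chain. *)
Lemma chain_mass_cluster_mass (n : nat) (x : S) :
  \esum_(s in [set: n.-tuple S])
    (chain_prod (conn_prob P K t0) x s * cluster_mass t0 (last x s)) =
  chain_mass n.+1 x.
Proof.
rewrite /chain_mass (esum_tuple_rcons _
  (a := fun s => chain_prod (conn_prob P K t0) x s * f (last x s))); last first.
  by move=> s; rewrite mule_ge0// chain_prod_ge0.
apply: eq_esum => s _; rewrite cluster_mass_t0 -esumZl.
- apply: eq_esum => y _; rewrite last_rcons muleA; congr (_ * _).
  rewrite /chain_prod size_rcons big_nat_recr//=; congr (_ * _).
    apply: eq_big_nat => i /= im; rewrite -rcons_cons !nth_rcons/= im.
    by rewrite ltnS (ltnW im).
  by rewrite -rcons_cons !nth_rcons/= ltnSn ltnn eqxx -last_nth.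
- exact: chain_prod_fin_num.
- by move=> y; rewrite mule_ge0// conn_prob_ge0.
- exact: chain_prod_ge0.
Qed.

Lemma cluster_mass_finite :
  (forall x n, (0 < n)%N -> chain_mass n x < +oo) ->
  forall x t, (0 <= t)%R -> cluster_mass t x < +oo.
Proof.
move=> chain x t; rewrite le_eqVlt => /orP[/eqP <-|t_gt0].
  by rewrite cluster_mass0 (le_lt_trans (le_chain_mass1 x))// chain.
(* The level of t is the least n with t <= (n + 1) t0. *)
have ex_n : exists n : nat, (t <= n.+1%:R * t0)%R.
  exists (Num.truncn (t / t0)); rewrite -ler_pdivrMr// ltW//.
  exact: truncnS_gt.
have tr := ex_minnP ex_n; case: tr => r tr rmin.
apply: (le_lt_trans (@cluster_mass_le r _ _ _ tr)); last exact: chain.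
case: r tr rmin => [|r] tr rmin; first by rewrite mul0r.
by rewrite ltNge; apply/negP => /rmin; rewrite ltnn.
Qed.

End Jumps.
(** * The two moment conditions *)

Theorem proposition5p16 (R : realType) (S : countType)
    (S_infinite : infinite_set [set: S])
    (c : S -> S -> R)
    (c_ge0 : forall x y : S, (0 <= c x y)%R)
    (c_diag : forall x : S, c x x = 0%R)
    (d : measure_display) (Omega : measurableType d) (P : probability Omega R)
    (K : Omega -> S -> S -> R -> nat)
    (K_poisson : poisson_family P c K)
    (t0 : R) (SEP : assumption_SEP P K t0) :
  let p := conn_prob P K t0 in
  let C_card := fun (t : R) (x : S) =>
    \int[P]_w counting (graph_cluster t0 (K w) t x) in
  let C_rate := fun (t : R) (x : S) =>
    \int[P]_w \esum_(z in graph_cluster t0 (K w) t x) total_rate c z in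
  let card_cond := forall (x : S) (t : R), (0 <= t)%R -> C_card t x < +oo in
  let card_chain := forall (x : S) (n : nat), (0 < n)%N ->
    \esum_(s in [set: n.-tuple S]) chain_prod p x s < +oo in
  let card_chain' := forall (x : S) (n : nat),
    \esum_(s in [set: n.-tuple S])
      (chain_prod p x s * C_card t0 (last x s)) < +oo in
  let rate_cond := forall (x : S) (t : R), (0 <= t)%R -> C_rate t x < +oo in
  let rate_chain := forall (x : S) (n : nat), (0 < n)%N ->
    \esum_(s in [set: n.-tuple S])
      (chain_prod p x s * total_rate c (last x s)) < +oo in
  let rate_chain' := forall (x : S) (n : nat),
    \esum_(s in [set: n.-tuple S])
      (chain_prod p x s * C_rate t0 (last x s)) < +oo in
  [/\ card_chain -> card_cond, card_chain <-> card_chain',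
      rate_chain -> rate_cond & rate_chain <-> rate_chain'].
Proof.
move=> p C_card C_rate card_cond card_chain card_chain' rate_cond rate_chain
  rate_chain'.
have [t0_gt0 _] := SEP.
have rate_ge0 x : 0 <= total_rate c x.
  by apply: esum_ge0 => y _; rewrite lee_fin addr_ge0.
have one_ge0 (x : S) : 0 <= (1 : \bar R) by [].
have cardE t x : C_card t x = cluster_mass P K t0 (fun=> 1) t x.
  by apply: eq_integral => w _; rewrite counting_esum.
have card_chainE n x : \esum_(s in [set: n.-tuple S]) chain_prod p x s =
    chain_mass P K t0 (fun=> 1) n x.
  by apply: eq_esum => s _; rewrite mule1.
have card_chainE' n x : \esum_(s in [set: n.-tuple S])
    (chain_prod p x s * C_card t0 (last x s)) = chain_mass P K t0 (fun=> 1) n.+1 x.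
  rewrite -(chain_mass_cluster_mass K_poisson t0_gt0 one_ge0).
  by apply: eq_esum => s _; rewrite cardE.
have rate_chainE' n x : \esum_(s in [set: n.-tuple S])
    (chain_prod p x s * C_rate t0 (last x s)) =
    chain_mass P K t0 (total_rate c) n.+1 x.
  by rewrite -(chain_mass_cluster_mass K_poisson t0_gt0 rate_ge0).
split.
- move=> chain x t t_ge0; rewrite cardE.
  apply: (cluster_mass_finite K_poisson t0_gt0 one_ge0) => // y n n_gt0.
  by rewrite -card_chainE; exact: chain.
- split=> [chain x n|chain x [//|n] _].
    by rewrite card_chainE' -card_chainE; exact: chain.
  by rewrite card_chainE -card_chainE'; exact: chain.
- move=> chain x t t_ge0.
  exact: (cluster_mass_finite K_poisson t0_gt0 rate_ge0 chain).
- split=> [chain x n|chain x [//|n] _].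
    by rewrite rate_chainE'; exact: chain.
  by have := chain x n; rewrite rate_chainE'.
Qed.
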